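(* Let $(\mathcal E,\mathfrak a,\mathfrak b)$ be a quasi-twilled Lie conformal algebra and $D:\mathfrak a\to\mathfrak b$ a right deformation map. Define $\varrho^D_{\mathfrak a}:\mathfrak a\to\mathrm{Cend}(\mathfrak b)$ by $$\varrho^D_{\mathfrak a}(a)_\lambda u=\varrho_{\mathfrak a}(a)_\lambda u+\{D(a)_\lambda u\}_{\mathfrak b}+D\bigl(\varrho_{\mathfrak b}(u)_{-\lambda-\partial}a\bigr),\qquad a\in\mathfrak a,\ u\in\mathfrak b.$$ Then $(\mathfrak b,\varrho^D_{\mathfrak a})$ is a representation of the Lie conformal algebra $\mathfrak a^D$, where $\mathfrak a^D$ is the $\mathbb C[\partial]$-module $\mathfrak a$ equipped with the $\lambda$-bracket $\{a_\lambda b\}^D_{\mathfrak a}=\{a_\lambda b\}_{\mathfrak a}+\varrho_{\mathfrak b}(D(a))_\lambda b-\varrho_{\mathfrak b}(D(b))_{-\lambda-\partial}a$.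
   Context: All vector spaces and linear maps are over $\mathbb C$, and all $\mathbb C[\partial]$-modules are finitely generated. A Lie conformal algebra is a $\mathbb C[\partial]$-module $\mathcal E$ with a $\mathbb C$-linear map $\mathcal E\otimes\mathcal E\to\mathcal E[\lambda]$, $x\otimes y\mapsto\{x_\lambda y\}$, such that $\{\partial x_\lambda y\}=-\lambda\{x_\lambda y\}$, $\{x_\lambda\partial y\}=(\partial+\lambda)\{x_\lambda y\}$, $\{x_\lambda y\}=-\{y_{-\lambda-\partial}x\}$ and $\{x_\lambda\{y_\mu z\}\}=\{\{x_\lambda y\}_{\lambda+\mu}z\}+\{y_\mu\{x_\lambda z\}\}$. Here and below the subscript $-\lambda-\partial$ means that the formal variable is replaced by $-\lambda-\partial$, with $\partial$ acting from the left on the coefficients. $\mathbb C[\partial]$-module maps are extended to polynomials coefficientwise. For a $\mathbb C[\partial]$-module $M$, $\mathrm{Cend}(M)$ is the space of $\mathbb C$-linear maps $f_\lambda:M\to M[\lambda]$ with $f_\lambda(\partial m)=(\partial+\lambda)f_\lambda m$. A representation (module) of a Lie conformal algebra $\mathcal E$ is a $\mathbb C[\partial]$-module $M$ with a $\mathbb C$-linear map $\varrho:\mathcal E\to\mathrm{Cend}(M)$ such that $\varrho(\partial x)_\lambda=-\lambda\varrho(x)_\lambda$ and $\varrho(x)_\lambda\varrho(y)_\mu-\varrho(y)_\mu\varrho(x)_\lambda=\varrho(\{x_\lambda y\})_{\lambda+\mu}$. A quasi-twilled Lie conformal algebra $(\mathcal E,\mathfrak a,\mathfrak b)$ is a Lie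 conformal algebra $\mathcal E$ with a decomposition $\mathcal E=\mathfrak a\oplus\mathfrak b$ of $\mathbb C[\partial]$-modules such that $\mathfrak b$ is a Lie conformal subalgebra. With $\mathrm{pr}_{\mathfrak a},\mathrm{pr}_{\mathfrak b}$ the projections, for $a,b\in\mathfrak a$, $u,v\in\mathfrak b$ set $\{a_\lambda b\}_{\mathfrak a}=\mathrm{pr}_{\mathfrak a}\{a_\lambda b\}$, $\psi_{1,\lambda}(a,b)=\mathrm{pr}_{\mathfrak b}\{a_\lambda b\}$, $\varrho_{\mathfrak b}(u)_\lambda a=\mathrm{pr}_{\mathfrak a}\{u_\lambda a\}$, $\varrho_{\mathfrak a}(a)_\lambda v=\mathrm{pr}_{\mathfrak b}\{a_\lambda v\}$, $\{u_\lambda v\}_{\mathfrak b}=\mathrm{pr}_{\mathfrak b}\{u_\lambda v\}=\{u_\lambda v\}$. A right deformation map of $(\mathcal E,\mathfrak a,\mathfrak b)$ is a $\mathbb C[\partial]$-module homomorphism $D:\mathfrak a\to\mathfrak b$ whose graph $\mathrm{Gr}(D)=\{(a,D(a))\mid a\in\mathfrak a\}\subset\mathfrak a\oplus\mathfrak b=\mathcal E$ is a Lie conformal subalgebra of $\mathcal E$. For such $D$, the bracket $\{\cdot_\lambda\cdot\}^D_{\mathfrak a}$ is a Lie conformal algebra structure on $\mathfrak a$. *)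

(* Defs.v *)
From HB Require Import structures.
From mathcomp Require Import all_boot all_order all_algebra.
From mathcomp Require Import finmap complex classical_sets reals.
From mathcomp Require Export monalg.

Set Implicit Arguments.
Unset Strict Implicit.
Unset Printing Implicit Defensive.

Import GRing.Theory.

Local Open Scope ring_scope.
Local Open Scope classical_set_scope.

(* [lpoly M] is M[lambda]: finitely supported sequences of elements of M, with
   P@_n the coefficient of lambda^n.  For an A-module M it is a module over
   {poly A}, whose indeterminate 'X acts as lambda.  Hence, for a
   K[partial]-module M (A = {poly K}), the scalars of [lpoly M] are
   K[partial][lambda], so that partial%:P acts coefficientwise. *)
Definition lpoly (A : comNzRingType) (M : lmodType A) : Type := {malg M[nat]}.

Section LPolyModule.
Variables (A : comNzRingType) (M : lmodType A).

HB.instance Definition _ := GRing.Zmodule.on (lpoly M).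

Definition lscale (p : {poly A}) (P : lpoly M) : lpoly M :=
  \sum_(i < size p) \sum_(n <- msupp P) << p`_i *: P@_n *g (i + n)%N >>.

Lemma lscaleE p P k :
  (lscale p P)@_k = \sum_(i < k.+1) p`_i *: P@_(k - i)%N.
Proof.
pose F i := if (i <= k)%N then p`_i *: P@_(k - i)%N else 0.
have F0 i : ~~ (i < size p)%N -> F i = 0.
  by rewrite -leqNgt /F => ?; case: ifP => // _; rewrite nth_default ?scale0r.
transitivity (\sum_(i < size p) F i).
  rewrite /lscale raddf_sum; apply: eq_bigr => i _; rewrite raddf_sum /= /F.
  under eq_bigr do rewrite mcoeffU.
  case: leqP => ik; last first.
    by apply: big1 => n _; case: eqP => // E; rewrite -E ltnNge leq_addr in ik.
  have E n : ((i + n)%N == k) = (n == (k - i)%N).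
    by apply/eqP/eqP => [<-|->]; rewrite ?addKn ?subnKC.
  under eq_bigr do rewrite E mulrb.
  case: (msuppP P (k - i)%N) => [Pn|nP].
    rewrite (big_rem _ Pn) /= eqxx big1_seq ?addr0 // => n /=.
    by rewrite mem_rem_uniq ?fset_uniq // inE => /andP[/negPf->].
  rewrite scaler0 big_seq big1 // => n nn.
  by case: eqP => // nk; rewrite -nk nn in nP.
have W (m m' : nat) : (m <= m')%N -> (forall i, ~~ (i < m)%N -> F i = 0) ->
    \sum_(i < m) F i = \sum_(i < m') F i.
  move=> mm' Fm; rewrite (big_ord_widen m' F mm') big_mkcond.
  by apply: eq_bigr => i _; case: ifPn => // /Fm ->.
have Fk i : ~~ (i < k.+1)%N -> F i = 0 by rewrite /F ltnS => /negPf->.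
rewrite (W _ (maxn (size p) k.+1) (leq_maxl _ _) F0).
rewrite -(W _ (maxn (size p) k.+1) (leq_maxr _ _) Fk).
by apply: eq_bigr => i _; rewrite /F -ltnS ltn_ord.
Qed.

Fact lscaleA a b P : lscale a (lscale b P) = lscale (a * b) P.
Proof.
apply/malgP => k; rewrite !lscaleE.
pose c i j := (a`_i * b`_j) *: P@_(k - (i + j))%N.
transitivity (\sum_(i < k.+1) \sum_(m < k.+1 | (i <= m)%N) c i (m - i)%N).
  apply: eq_bigr => i _; rewrite lscaleE scaler_sumr.
  have ik : (i <= k)%N by rewrite -ltnS.
  symmetry; rewrite -(big_mkord (fun m => i <= m)%N (fun m => c i (m - i)%N)).
  rewrite (@big_cat_nat _ _ _ i) ?leqW //= [X in X + _]big1_seq ?add0r; last first.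
    by move=> m; rewrite mem_index_iota /= ltnNge => /andP[->].
  rewrite -{1}[i : nat]add0n big_addn subSn // big_mkord.
  apply: eq_big => [j|j _]; first by rewrite leq_addl.
  by rewrite addnK /c scalerA subnDA.
rewrite (exchange_big_dep predT) //=; apply: eq_bigr => m _.
rewrite coefM scaler_suml.
have mk : (m.+1 <= k.+1)%N by [].
rewrite (big_ord_widen k.+1 (fun i => (a`_i * b`_(m - i)) *: P@_(k - m)%N) mk).
by apply: eq_big => [i|i im]; rewrite ?ltnS // /c subnKC.
Qed.

Fact lscale1 : left_id 1 lscale.
Proof.
move=> P; apply/malgP => k; rewrite lscaleE big_ord_recl coef1 scale1r subn0.
by rewrite big1 ?addr0 // => i _; rewrite coef1 scale0r.
Qed.

Fact lscaleDr : right_distributive lscale +%R.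
Proof.
move=> a P Q; apply/malgP => k; rewrite mcoeffD !lscaleE -big_split.
by apply: eq_bigr => i _; rewrite mcoeffD scalerDr.
Qed.

Fact lscaleDl P : {morph lscale^~ P : a b / a + b}.
Proof.
move=> a b; apply/malgP => k; rewrite mcoeffD !lscaleE -big_split.
by apply: eq_bigr => i _; rewrite coefD scalerDl.
Qed.

HB.instance Definition _ := GRing.Zmodule_isLmodule.Build {poly A} (lpoly M)
  lscaleA lscale1 lscaleDr lscaleDl.

End LPolyModule.

(* [lsubst f t P] is the sum of the t^n f(m_n), where P is the sum of the
   lambda^n m_n: apply f to the coefficients, then replace lambda by t. *)
Definition lsubst (A B : comNzRingType) (M : lmodType A) (V : lmodType B)
    (f : M -> V) (t : B) (P : lpoly M) : V :=
  \sum_(n <- msupp P) t ^+ n *: f P@_n.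

Definition lconst (A : comNzRingType) (M : lmodType A) (m : M) : lpoly M :=
  << m *g 0%N >>.

Definition lmap (A : comNzRingType) (M N : lmodType A) (f : M -> N) :
    lpoly M -> lpoly N :=
  lsubst (fun m => lconst (f m)) 'X.

Section ConformalAlgebra.
Variable K : fieldType.

Definition partial : {poly K} := 'X.

Definition finitely_generated (M : lmodType {poly K}) : Prop :=
  exists s : seq M, forall m : M, exists c : 'I_(size s) -> {poly K},
    m = \sum_i c i *: s`_i.

Definition K_linear (M N : lmodType {poly K}) (f : M -> lpoly N) : Prop :=
  forall (c : K) (x y : M), f (c%:P *: x + y) = c%:P%:P *: f x + f y.

Definition lambda : {poly {poly K}} := 'X.

(* P(lambda) |-> P(- lambda - partial) *)
Definition lneg (M : lmodType {poly K}) : lpoly M -> lpoly M :=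
  lsubst (@lconst _ M) (- lambda - partial%:P).

(* M[lambda, mu] is encoded as M[lambda][mu]. *)
Definition lpoly2 (M : lmodType {poly K}) := lpoly (lpoly M).
Definition lambda2 : {poly {poly {poly K}}} := 'X%:P.
Definition mu2 : {poly {poly {poly K}}} := 'X.
(* P(lambda) |-> P(t), for t in K[partial][lambda][mu] *)
Definition leval2 (M : lmodType {poly K}) (t : {poly {poly {poly K}}}) :
    lpoly M -> lpoly2 M :=
  lsubst (fun m => lconst (lconst m)) t.

(* [lcomp f s g t m] is f_s (g_t m). *)
Definition lcomp (M : lmodType {poly K}) (f : M -> lpoly M)
    (s : {poly {poly {poly K}}}) (g : M -> lpoly M)
    (t : {poly {poly {poly K}}}) (m : M) : lpoly2 M :=
  lsubst (fun w => leval2 s (f w)) t (g m).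

Record is_lie_conformal (E : lmodType {poly K}) (br : E -> E -> lpoly E) :
    Prop := IsLieConformal {
  lc_fg : finitely_generated E;
  lc_linl : forall y, K_linear (br^~ y);
  lc_linr : forall x, K_linear (br x);
  lc_sesql : forall x y, br (partial *: x) y = - lambda *: br x y;
  lc_sesqr : forall x y, br x (partial *: y) = (partial%:P + lambda) *: br x y;
  lc_skew : forall x y, br x y = - lneg (br y x);
  lc_jacobi : forall x y z,
    lcomp (br x) lambda2 (br y) mu2 z =
    lsubst (fun w => leval2 (lambda2 + mu2) (br w z)) lambda2 (br x y)
    + lcomp (br y) mu2 (br x) lambda2 z
}.

Record is_subalgebra (E : lmodType {poly K}) (br : E -> E -> lpoly E)
    (S : set E) : Prop := IsSubalgebra {
  sub_0 : S 0;
  sub_lin : forall (p : {poly K}) x y, S x -> S y -> S (p *: x + y);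
  sub_br : forall x y n, S x -> S y -> S (br x y)@_n
}.

Record is_cend (M : lmodType {poly K}) (f : M -> lpoly M) : Prop := IsCend {
  cend_lin : K_linear f;
  cend_partial : forall m, f (partial *: m) = (partial%:P + lambda) *: f m
}.

Record is_representation (E : lmodType {poly K}) (br : E -> E -> lpoly E)
    (M : lmodType {poly K}) (rho : E -> M -> lpoly M) : Prop :=
  IsRepresentation {
  rep_fg : finitely_generated M;
  rep_cend : forall x, is_cend (rho x);
  rep_lin : forall m, K_linear (rho^~ m);
  rep_partial : forall x m, rho (partial *: x) m = - lambda *: rho x m;
  rep_comm : forall x y m,
    lcomp (rho x) lambda2 (rho y) mu2 m - lcomp (rho y) mu2 (rho x) lambda2 m =
    lsubst (fun w => leval2 (lambda2 + mu2) (rho w m)) lambda2 (br x y)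
}.

(* The decomposition E = a (+) b is the product module a * b, with a and b
   embedded as (x, 0) and (0, u), and projections fst and snd. *)
Section QuasiTwilled.
Variables a b : lmodType {poly K}.
Local Notation E := (a * b)%type.
Variable br : E -> E -> lpoly E.

Definition is_quasi_twilled : Prop :=
  is_lie_conformal br /\ is_subalgebra br (range (fun u : b => (0, u) : E)).

Definition pra : lpoly E -> lpoly a := lmap fst.
Definition prb : lpoly E -> lpoly b := lmap snd.

Definition bra (x y : a) : lpoly a := pra (br (x, 0) (y, 0)).
Definition brb (u v : b) : lpoly b := prb (br (0, u) (0, v)).
Definition rhoa (x : a) (v : b) : lpoly b := prb (br (x, 0) (0, v)).
Definition rhob (u : b) (x : a) : lpoly a := pra (br (0, u) (x, 0)).

Definition is_right_deformation (D : {linear a -> b}) : Prop :=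
  is_subalgebra br (range (fun x : a => (x, D x) : E)).

Definition braD (D : {linear a -> b}) (x y : a) : lpoly a :=
  bra x y + rhob (D x) y - lneg (rhob (D y) x).

Definition rhoaD (D : {linear a -> b}) (x : a) (u : b) : lpoly b :=
  rhoa x u + brb (D x) u + lmap D (lneg (rhob u x)).

End QuasiTwilled.
End ConformalAlgebra.

(* Main.v *)
Require Import Defs.
From HB Require Import structures.
From mathcomp Require Import all_boot all_order all_algebra.
From mathcomp Require Import finmap complex reals.

(** The graph embedding [G x = (x, D x)] identifies [a] with the subalgebra
    Gr(D) of [E = a (+) b], and [Q z = z.2 - D z.1] is the projection onto [b]
    along Gr(D).  The formulas of the statement are the resulting transported
    structures:

    - the bracket of [a^D] is the one that [G] pulls back from Gr(D): expanding
      [{(x, Dx)_lambda (y, Dy)}] bilinearly and projecting to [a] gives exactly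
      [braD], the term [{Dx_lambda Dy}] lying in [b] and the term
      [{x_lambda Dy}] being turned around by skew-symmetry
      ([lmap_graph_braD]);
    - as Gr(D) is a subalgebra, it acts on the quotient [E / Gr(D)], which [Q]
      identifies with [b]; computed on representatives [(0, u)], that action is
      [rhoaD] ([rhoaD_coproj]).

    So the theorem is an instance of two general facts: a bracket carried by an
    injective map to a Lie conformal bracket is Lie conformal
    ([lie_conformal_pullback]), and an action induced on a quotient by a
    subalgebra is a representation ([quotient_representation]).  Both hold
    because coefficientwise extension of a linear map commutes with every
    substitution for [lambda] ([linear_lsubst], [lsubst_lmap]), so that each
    axiom is carried over from [E]. *)

Set Implicit Arguments.
Unset Strict Implicit.
Unset Printing Implicit Defensive.

Import GRing.Theory.

Local Open Scope ring_scope.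

(** * Coefficientwise extension and substitution *)

Section Substitution.

Lemma lconst_scale_coef (A : comNzRingType) (M : lmodType A) (p : {poly A})
  (m : M) k : (p *: lconst m : lpoly M)@_k = p`_k *: m.
Proof.
rewrite [LHS]lscaleE big_ord_recr /= subnn mcoeffUU big1 ?add0r // => i _.
by rewrite mcoeffU eq_sym subn_eq0 leqNgt ltn_ord /= mulr0n scaler0.
Qed.

Lemma coef_lmap (A : comNzRingType) (M N : lmodType A) (f : {linear M -> N})
  (P : lpoly M) k : (lmap f P)@_k = f P@_k.
Proof.
rewrite /lmap /lsubst raddf_sum /=.
under eq_bigr do rewrite lconst_scale_coef coefXn scaler_nat mulrb eq_sym.
rewrite -big_mkcond /=; case: (msuppP P k) => [Pk|nP].
  by rewrite -big_filter filter_pred1_uniq ?fset_uniq // big_seq1.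
rewrite linear0 big_seq_cond big1 // => n /andP[nn /eqP nk].
by rewrite -nk nn in nP.
Qed.

Lemma lmap_inj (A : comNzRingType) (M N : lmodType A) (f : {linear M -> N}) :
  injective f -> injective (lmap f).
Proof.
move=> fI P Q PQ; apply/malgP => k; apply: fI.
exact: etrans (esym (coef_lmap f P k)) (etrans (congr1 _ PQ) (coef_lmap f Q k)).
Qed.

Lemma lmap_is_linear (A : comNzRingType) (M N : lmodType A)
  (f : {linear M -> N}) : linear (lmap f : lpoly M -> lpoly N).
Proof.
move=> p P Q; apply/malgP => k.
rewrite mcoeffD !coef_lmap mcoeffD linearD; congr (_ + _).
rewrite [in LHS]lscaleE [RHS]lscaleE raddf_sum; apply: eq_bigr => i _.
by rewrite /= linearZ coef_lmap.
Qed.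

HB.instance Definition _ (A : comNzRingType) (M N : lmodType A)
  (f : {linear M -> N}) := GRing.isLinear.Build {poly A} (lpoly M) (lpoly N)
    *:%R (lmap f) (lmap_is_linear f).

(** With the next two lemmas, a linear map can be moved across a substitution
    in either direction: onto the substituted values, or onto the coefficients. *)
Lemma linear_lsubst (A B : comNzRingType) (M : lmodType A) (V W : lmodType B)
  (h : {linear V -> W}) (f : M -> V) t (P : lpoly M) :
  h (lsubst f t P) = lsubst (h \o f) t P.
Proof.
by rewrite /lsubst raddf_sum; apply: eq_bigr => n _; rewrite /= linearZ.
Qed.

Lemma eq_lsubst (A B : comNzRingType) (M : lmodType A) (V : lmodType B)
  (f g : M -> V) t (P : lpoly M) : f =1 g -> lsubst f t P = lsubst g t P.
Proof. by move=> fg; apply: eq_bigr => n _; rewrite fg. Qed.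

Lemma lsubst_lmap (A B : comNzRingType) (M N : lmodType A) (V : lmodType B)
  (g : {linear M -> N}) (f : N -> V) t (P : lpoly M) :
  f 0 = 0 -> lsubst f t (lmap g P) = lsubst (f \o g) t P.
Proof.
move=> f0; rewrite /lsubst.
(* The support shrinks under [g], whence the condition on [f 0]. *)
under [RHS]eq_bigr do rewrite /= -coef_lmap.
apply: big_fset_incl => [|n _ nP]; last by rewrite mcoeff_outdom // f0 scaler0.
apply/fsubsetP => n; rewrite -!mcoeff_neq0 coef_lmap.
by apply: contraNN => /eqP->; rewrite linear0.
Qed.

Lemma lconst0 (A : comNzRingType) (M : lmodType A) : lconst (0 : M) = 0.
Proof. exact: monalgU0. Qed.

Lemma lmap_lconst (A : comNzRingType) (M N : lmodType A) (f : {linear M -> N})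
  (m : M) : lmap f (lconst m) = lconst (f m).
Proof.
apply/malgP => k; rewrite coef_lmap !mcoeffU.
by case: eqP; rewrite ?linear0.
Qed.

Lemma lsubst0 (A B : comNzRingType) (M : lmodType A) (V : lmodType B)
  (f : M -> V) t : lsubst f t (0 : lpoly M) = 0.
Proof. by rewrite /lsubst msupp0 big_seq_fset0. Qed.

End Substitution.

(** * Transport of conformal structures along linear maps *)

Section Transport.
Variable K : fieldType.
Implicit Types E F M N : lmodType {poly K}.

Lemma K_linear0 E F (f : E -> lpoly F) : K_linear f -> f 0 = 0.
Proof.
move=> fL; have := fL 1 0 0.
by rewrite scaler0 addr0 !scale1r => /esym/eqP; rewrite -subr_eq0 addrK => /eqP.
Qed.

Lemma K_linearD E F (f : E -> lpoly F) : K_linear f -> {morph f : x y / x + y}.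
Proof. by move=> fL x y; have := fL 1 x y; rewrite !scale1r. Qed.

Lemma lmap_lneg E F (f : {linear E -> F}) (P : lpoly E) :
  lmap f (lneg P) = lneg (lmap f P).
Proof.
rewrite /lneg linear_lsubst lsubst_lmap; last exact: lconst0.
by apply: eq_lsubst => m /=; rewrite lmap_lconst.
Qed.

Lemma lmap_leval2 E F (f : {linear E -> F}) t (P : lpoly E) :
  lmap (lmap f) (leval2 t P) = leval2 t (lmap f P).
Proof.
rewrite /leval2 linear_lsubst lsubst_lmap; last by rewrite !lconst0.
by apply: eq_lsubst => m /=; rewrite lmap_lconst /= lmap_lconst.
Qed.

(** For the terms of the form [{{x_lambda y}_(lambda + mu) z}] in the Jacobi
    identity and in the commutation axiom of a representation: [P] is then
    [{x_lambda y}], and [g], [h] bracket its coefficients with [z]. *)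
Lemma lmap_lsubst_leval2 E M N (f : {linear M -> N}) (g : E -> lpoly M)
  (h : E -> lpoly N) s t (P : lpoly E) :
  (forall w, lmap f (g w) = h w) ->
  lmap (lmap f) (lsubst (fun w => leval2 s (g w)) t P) =
  lsubst (fun w => leval2 s (h w)) t P.
Proof.
move=> fg; rewrite linear_lsubst; apply: eq_lsubst => w /=.
by rewrite lmap_leval2 fg.
Qed.

Lemma lsubst_leval2_lmap E F N (G : {linear E -> F}) (h : F -> lpoly N) s t
  (P : lpoly E) :
  h 0 = 0 -> lsubst (fun w => leval2 s (h w)) t (lmap G P) =
             lsubst (fun w => leval2 s (h (G w))) t P.
Proof. by move=> h0; rewrite lsubst_lmap // h0 [LHS]lsubst0. Qed.

(** [f] may intertwine the endomorphisms without being injective or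
    surjective, so this serves both for the embedding of a subalgebra and for the
    projection to a quotient. *)
Lemma lmap_lcomp E F (f : {linear E -> F}) (g1 g2 : E -> lpoly E)
  (h1 h2 : F -> lpoly F) s t m :
  h1 0 = 0 -> (forall w, lmap f (g1 w) = h1 (f w)) ->
  (forall w, lmap f (g2 w) = h2 (f w)) ->
  lmap (lmap f) (lcomp g1 s g2 t m) = lcomp h1 s h2 t (f m).
Proof.
move=> h10 fg1 fg2; rewrite /lcomp -fg2 lsubst_leval2_lmap //.
exact: lmap_lsubst_leval2.
Qed.

Lemma finitely_generated_image E F (f : {linear E -> F}) (s : F -> E) :
  cancel s f -> finitely_generated E -> finitely_generated F.
Proof.
move=> sK [r rE]; exists (map f r) => m.
have [c mE] := rE (s m); exists (fun i => c (cast_ord (size_map f r) i)).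
rewrite -[LHS]sK mE raddf_sum (reindex (cast_ord (size_map f r))) /=.
  by apply: eq_bigr => i _; rewrite linearZ (nth_map 0) // -(size_map f).
apply: onW_bij; exists (cast_ord (esym (size_map f r))).
  exact: cast_ordK.
exact: cast_ordKV.
Qed.

(** Each axiom may be checked after applying [G], where it becomes the same
    axiom of the target. *)
Lemma lie_conformal_pullback E F (br : E -> E -> lpoly E)
  (brF : F -> F -> lpoly F) (G : {linear F -> E}) :
  is_lie_conformal br -> finitely_generated F -> injective G ->
  (forall x y, lmap G (brF x y) = br (G x) (G y)) ->
  is_lie_conformal brF.
Proof.
move=> [_ linl linr sesql sesqr skew jacobi] Ffg GI GE.
have GI1 := lmap_inj GI; split=> //.
- by move=> y c x x'; apply: GI1; rewrite [RHS]linearP /= !GE linearP linl.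
- by move=> x c y y'; apply: GI1; rewrite [RHS]linearP /= !GE linearP linr.
- by move=> x y; apply: GI1; rewrite [RHS]linearZ /= !GE linearZ sesql.
- by move=> x y; apply: GI1; rewrite [RHS]linearZ /= !GE linearZ sesqr.
- by move=> x y; apply: GI1; rewrite [RHS]linearN /= lmap_lneg !GE skew.
have br0 x : br x 0 = 0 by exact: K_linear0.
(* Abstracting the two variables stops unification from comparing their
   expressions as polynomials by computation. *)
move: (lambda2 K) (mu2 K) jacobi => l m jacobi x y z.
apply: (@lmap_inj _ _ _ (lmap G) GI1).
have Exy := lmap_lcomp l m z (br0 (G x)) (GE x) (GE y).
have Eyx := lmap_lcomp m l z (br0 (G y)) (GE y) (GE x).
have Ebr := lsubst_leval2_lmap G (l + m) l (brF x y) (K_linear0 (linl (G z))).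
have EG := lmap_lsubst_leval2 (l + m) l (brF x y) (GE^~ z).
rewrite GE in Ebr.
have Erhs := congr2 +%R (etrans EG (esym Ebr)) Eyx.
exact: etrans Exy (etrans (jacobi _ _ _) (esym (etrans (linearD _ _ _) Erhs))).
Qed.

(** Being determined by [Q] forces [rho] to be the action of the subalgebra
    [G F] on the quotient of the adjoint module [E] by the kernel of [Q], so
    that commutation is the Jacobi identity of [E]. *)
Lemma quotient_representation E F M (br : E -> E -> lpoly E)
  (brF : F -> F -> lpoly F) (rho : F -> M -> lpoly M)
  (G : {linear F -> E}) (Q : {linear E -> M}) (s : M -> E) :
  is_lie_conformal br -> cancel s Q ->
  (forall x y, lmap G (brF x y) = br (G x) (G y)) ->
  (forall x z, rho x (Q z) = lmap Q (br (G x) z)) ->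
  is_representation brF rho.
Proof.
move=> [Efg linl linr sesql sesqr _ jacobi] sK GE rhoE.
have rhoL x : K_linear (rho x).
  by move=> c u v; rewrite -[u]sK -[v]sK -linearP !rhoE linr linearP.
split.
- exact: finitely_generated_image sK Efg.
- move=> x; split=> // u.
  by rewrite -[u]sK -linearZ !rhoE sesqr linearZ.
- by move=> u c x y; rewrite -[u]sK !rhoE linearP linl linearP.
- by move=> x u; rewrite -[u]sK !rhoE linearZ sesql linearZ.
have rho0 x : rho x 0 = 0 by exact: K_linear0.
have QE x w : lmap Q (br (G x) w) = rho x (Q w) by rewrite rhoE.
move: (lambda2 K) (mu2 K) jacobi => l m jacobi x y u.
have Exy := lmap_lcomp l m (s u) (rho0 x) (QE x) (QE y).
have Eyx := lmap_lcomp m l (s u) (rho0 y) (QE y) (QE x).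
have Ebr := lsubst_leval2_lmap G (l + m) l (brF x y) (K_linear0 (linl (s u))).
rewrite GE in Ebr.
have EQ := lmap_lsubst_leval2 (l + m) l (brF x y) (QE^~ (s u)).
have J := congr1 (lmap (lmap Q)) (jacobi (G x) (G y) (s u)).
rewrite sK in Exy Eyx EQ.
rewrite -Exy -Eyx J linearD addrK.
exact: etrans (congr1 (lmap (lmap Q)) Ebr) EQ.
Qed.

End Transport.

(** * The graph of a deformation map and the projection along it *)

Section Graph.
Variables (A : nzRingType) (a b : lmodType A) (D : {linear a -> b}).

Definition graph (x : a) : a * b := (x, D x).

Definition coproj (z : a * b) : b := z.2 - D z.1.

Lemma graph_is_linear : linear graph.
Proof. by move=> p x y; rewrite /graph linearP. Qed.

HB.instance Definition _ :=
  GRing.isLinear.Build A a (a * b)%type *:%R graph graph_is_linear.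

Lemma coproj_is_linear : linear coproj.
Proof.
move=> p x y; rewrite /coproj /= linearP scalerBr opprD.
by rewrite addrACA.
Qed.

HB.instance Definition _ :=
  GRing.isLinear.Build A (a * b)%type b *:%R coproj coproj_is_linear.

Lemma coproj_graph x : coproj (graph x) = 0.
Proof. exact: subrr. Qed.

Lemma coproj_incl u : coproj (0, u) = u.
Proof. by rewrite /coproj linear0 subr0. Qed.

Lemma graph_coproj z : z = graph z.1 + (0, coproj z).
Proof.
by case: z => x u; congr (_, _); rewrite /= ?addr0 // addrC subrK.
Qed.

End Graph.

Section Deformation.
Variables (K : fieldType) (a b : lmodType {poly K}).
Variable br : (a * b)%type -> (a * b)%type -> lpoly (a * b)%type.
Hypothesis hE : is_quasi_twilled br.
Variable D : {linear a -> b}.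
Hypothesis hD : is_right_deformation br D.

Let brL := hE.1.
Let brDl y : {morph br^~ y : x x' / x + x'} := K_linearD (lc_linl brL y).
Let brDr x : {morph br x : y y' / y + y'} := K_linearD (lc_linr brL x).

Lemma graph_split x : graph D x = (x, 0) + (0, D x).
Proof. by congr (_, _); rewrite /= ?addr0 ?add0r. Qed.

Lemma lmap_fst_br_b u v : lmap fst (br (0, u) (0, v)) = 0.
Proof.
apply/malgP => k; rewrite coef_lmap mcoeff0.
have [] := sub_br hE.2 (x := (0, u)) (y := (0, v)) k; [by exists u|by exists v|].
by move=> w _ <-.
Qed.

Lemma lmap_fst_br_ab x v :
  lmap fst (br (x, 0) (0, v)) = - lneg (rhob br v x).
Proof. by rewrite (lc_skew brL) linearN /= lmap_lneg. Qed.

Lemma br_graph_closed x y k :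
  exists w, (br (graph D x) (graph D y))@_k = graph D w.
Proof.
have [] := sub_br hD (x := graph D x) (y := graph D y) k.
- by exists x.
- by exists y.
by move=> w _ <-; exists w.
Qed.

Lemma lmap_fst_br_graph x y :
  lmap fst (br (graph D x) (graph D y)) = braD br D x y.
Proof.
rewrite !graph_split brDl !brDr !linearD /= lmap_fst_br_b lmap_fst_br_ab addr0.
by rewrite addrAC.
Qed.

(** A bracket of two elements of the graph lies in the graph, hence is
    recovered from its component in [a]. *)
Lemma lmap_graph_braD x y :
  lmap (graph D) (braD br D x y) = br (graph D x) (graph D y).
Proof.
rewrite -lmap_fst_br_graph; apply/malgP => k; rewrite !coef_lmap.
by have [w ->] := br_graph_closed x y k.
Qed.

Lemma lmap_coproj (P : lpoly (a * b)%type) :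
  lmap (coproj D) P = lmap snd P - lmap D (lmap fst P).
Proof. by apply/malgP => k; rewrite mcoeffB !coef_lmap. Qed.

(** The graph component of [z] contributes nothing, its bracket with the graph
    being killed by the projection; on [(0, u)] the formula is the definition of
    [rhoaD] up to one use of skew-symmetry. *)
Lemma rhoaD_coproj x z :
  rhoaD br D x (coproj D z) = lmap (coproj D) (br (graph D x) z).
Proof.
rewrite [in RHS](graph_coproj D z) brDr linearD.
rewrite [X in X + _](_ : _ = 0) ?add0r; last first.
  apply/malgP => k; rewrite coef_lmap mcoeff0.
  by have [w ->] := br_graph_closed x z.1 k; apply: coproj_graph.
rewrite [RHS]lmap_coproj graph_split brDl !linearD /=.
by rewrite lmap_fst_br_b lmap_fst_br_ab linear0 subr0 linearN opprK.
Qed.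

End Deformation.

Theorem theorem3p12 (R : realType) (a b : lmodType {poly R[i]})
    (br : (a * b)%type -> (a * b)%type -> lpoly (a * b)%type)
    (hE : is_quasi_twilled br)
    (D : {linear a -> b}) (hD : is_right_deformation br D) :
  is_lie_conformal (braD br D) /\ is_representation (braD br D) (rhoaD br D).
Proof.
have GE := lmap_graph_braD hE hD; split.
  apply: (lie_conformal_pullback hE.1) GE; last by move=> x y [].
  apply: (finitely_generated_image (f := fst) (s := fun x : a => (x, 0))) => //.
  exact: lc_fg hE.1.
exact: quotient_representation hE.1 (@coproj_incl _ _ _ D) GE
  (rhoaD_coproj hE hD).
Qed.
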